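(* Let $H,K$ be complex Hilbert spaces, let $A\in CR(K,H)\cap BCR(K,H)$ and $B\in CR(H,K)\cap BCR(H,K)$, and let $$T=\begin{bmatrix} 0 & A \\ B & 0 \end{bmatrix}=\bigl\{\{(x,y),(y_a,x_b)\}:\{x,x_b\}\in B,\ \{y,y_a\}\in A\bigr\},$$ a linear relation in $H\times K$ with domain $H\times K$. Assume that $AB$ and $BA$ are closed linear relations in $H$ and $K$, respectively. Then $$\sigma_{e_2}(T)=\{\lambda\in\mathbb{C}:\lambda^2\in\sigma_{e_2}(AB)\cup\sigma_{e_2}(BA)\}.$$
   Context: A linear relation from a Hilbert space $H$ into a Hilbert space $K$ is a linear subspace $T$ of $H\times K$, whose elements are written $\{x,y\}$; $CR(H,K)$ is the set of those that are closed subspaces. $D(T)=\{x:\{x,y\}\in T\text{ for some }y\}$, $R(T)=\{y:\{x,y\}\in T\text{ for some }x\}$, $M(T)=\{y:\{0,y\}\in T\}$. $Q_T$ is the quotient map $K\to K/\overline{M(T)}$; $T$ is continuous if the operator $Q_TT$ is bounded, and $BCR(H,K)$ is the set of continuous linear relations with $D(T)=H$. Products: $TS=\{\{x,y\}:\{x,z\}\in S,\ \{z,y\}\in T\text{ for some }z\}$. For $\lambda\in\mathbb{C}$, $T-\lambda I=\{\{x,y-\lambda x\}:\{x,y\}\in T\}$. $\phi_-(H,K)$ is the set of closed linear relations from $H$ into $K$ whose range $R(T)$ is a closed subspace of $K$ of finite codimension. For a closed linear relation $T$ in a Hilbert space $X$, $\sigma_{e_2}(T)=\{\lambda\in\mathbb{C}:T-\lambda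 I\notin\phi_-(X,X)\}$. $H\times K$ is the Hilbert space direct sum. *)

(* Defs.v *)
From HB Require Import structures.
From mathcomp Require Import all_boot all_order all_algebra.
From mathcomp Require Import ring.
From mathcomp Require Import complex.
From mathcomp Require Import all_classical all_reals all_analysis.

Set Implicit Arguments.
Unset Strict Implicit.
Unset Printing Implicit Defensive.

Import Order.TTheory GRing.Theory Num.Theory.
Import numFieldNormedType.Exports.

Local Open Scope classical_set_scope.
Local Open Scope ring_scope.

HB.mixin Record NormedModule_isInnerProduct (C : numClosedFieldType) V
    & NormedModule C V := {
  hdot : {dot V for Num.conj} ;
  hdotE : forall x : V, hdot x x = `|x| ^+ 2
}.

(* [C] is only meant to be instantiated with [R[i]] for a [realType] [R]:
   [hilbertType R[i]] is the type of complex Hilbert spaces. *)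
#[short(type="hilbertType")]
HB.structure Definition Hilbert (C : numClosedFieldType) :=
  {V of CompleteNormedModule C V & NormedModule_isInnerProduct C V}.

(* The product type [H * K] carries the max norm in the library, hence the
   alias, which carries the norm of the Hilbert space direct sum. *)
Definition hsum (C : numClosedFieldType) (H K : hilbertType C) : Type :=
  (H * K)%type.

Section HilbertDirectSum.
Variables (C : numClosedFieldType) (H K : hilbertType C).

HB.instance Definition _ := GRing.Lmodule.copy (hsum H K) (H * K)%type.

Implicit Types u v w : hsum H K.

Definition hsum_norm u : C := sqrtC (`|u.1| ^+ 2 + `|u.2| ^+ 2).

Let nsq_ge0 (a b : C) : 0 <= a -> 0 <= b -> 0 <= a ^+ 2 + b ^+ 2.
Proof. by move=> a0 b0; rewrite addr_ge0 ?exprn_ge0. Qed.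

Let minkowski2 (a b c d : C) : 0 <= a -> 0 <= b -> 0 <= c -> 0 <= d ->
  sqrtC ((a + b) ^+ 2 + (c + d) ^+ 2) <=
  sqrtC (a ^+ 2 + c ^+ 2) + sqrtC (b ^+ 2 + d ^+ 2).
Proof.
move=> a0 b0 c0 d0.
have le_ab_cd : a * b + c * d <= sqrtC (a ^+ 2 + c ^+ 2) * sqrtC (b ^+ 2 + d ^+ 2).
  rewrite -ler_sqr ?nnegrE ?addr_ge0 ?mulr_ge0 ?sqrtC_ge0 ?nsq_ge0//.
  rewrite exprMn !sqrtCK -subr_ge0.
  have -> : (a ^+ 2 + c ^+ 2) * (b ^+ 2 + d ^+ 2) - (a * b + c * d) ^+ 2
    = (a * d - b * c) ^+ 2 by ring.
  by rewrite real_exprn_even_ge0// rpredB// rpredM// ger0_real.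
rewrite -ler_sqr ?nnegrE ?addr_ge0 ?sqrtC_ge0 ?nsq_ge0 ?addr_ge0//.
rewrite sqrtCK [leRHS]sqrrD !sqrtCK -subr_ge0.
move: le_ab_cd; move: (sqrtC _ * sqrtC _) => s le_ab_cd.
rewrite [leRHS](_ : _ = (s - (a * b + c * d)) *+ 2); last by ring.
by rewrite mulrn_wge0// subr_ge0.
Qed.

Let hsum_normD u v : hsum_norm (u + v) <= hsum_norm u + hsum_norm v.
Proof.
apply: le_trans
  (minkowski2 (normr_ge0 u.1) (normr_ge0 v.1) (normr_ge0 u.2) (normr_ge0 v.2)).
rewrite /hsum_norm ler_sqrtC ?nnegrE ?nsq_ge0 ?addr_ge0//.
by rewrite lerD// lerXn2r ?nnegrE ?addr_ge0// ler_normD.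
Qed.

Let hsum_normZ (l : C) u : hsum_norm (l *: u) = `|l| * hsum_norm u.
Proof.
rewrite /hsum_norm /= !normrZ !exprMn -mulrDr sqrtCM ?nnegrE ?exprn_ge0 ?nsq_ge0//.
by rewrite sqrCK.
Qed.

Let hsum_norm0_eq0 u : hsum_norm u = 0 -> u = 0.
Proof.
move=> /eqP; rewrite sqrtC_eq0 paddr_eq0 ?exprn_ge0//.
rewrite !sqrf_eq0 !normr_eq0.
by case: u => a b /= /andP[/eqP-> /eqP->].
Qed.

HB.instance Definition _ := Lmodule_isNormed.Build C (hsum H K)
  hsum_normD hsum_normZ hsum_norm0_eq0.

Lemma hsum_normE u : `|u| = sqrtC (`|u.1| ^+ 2 + `|u.2| ^+ 2).
Proof. by []. Qed.

Lemma hsum_norm1 u : `|u.1| <= `|u|.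
Proof.
rewrite hsum_normE -[leLHS]sqrCK// ler_sqrtC ?nnegrE ?exprn_ge0 ?nsq_ge0//.
by rewrite lerDl exprn_ge0.
Qed.

Lemma hsum_norm2 u : `|u.2| <= `|u|.
Proof.
rewrite hsum_normE -[leLHS]sqrCK// ler_sqrtC ?nnegrE ?exprn_ge0 ?nsq_ge0//.
by rewrite lerDr exprn_ge0.
Qed.

Lemma hsum_norm_le u : `|u| <= `|u.1| + `|u.2|.
Proof.
rewrite -ler_sqr ?nnegrE ?addr_ge0// hsum_normE sqrtCK sqrrD.
by rewrite addrAC lerDl mulrn_wge0// mulr_ge0.
Qed.

Let hsum_complete (F : set_system (hsum H K)) :
  ProperFilter F -> cauchy F -> cvg F.
Proof.
move=> FF /cauchy_ballP Fc.
have cauchy_map (L : hilbertType C) (f : hsum H K -> L) :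
    (forall u v, `|f u - f v| <= `|u - v|) -> cauchy (f @ F).
  move=> f1; apply/cauchy_ballP => e e0.
  have [[P Q] /= [FP FQ] PQ] := Fc _ e0.
  exists (f @` P, f @` Q) => /=.
    by split; rewrite /nbhs/=; [apply: filterS FP|apply: filterS FQ] => u Pu;
       exists u.
  move=> [_ _] /= [[u Pu <-] [v Qv <-]].
  have : ball u e v by exact: (PQ (u, v)).
  suff : ball u e v -> ball (f u) e (f v) by [].
  by rewrite -!ball_normE /ball_/=; apply: le_lt_trans.
have cv1 : cvg ((fst : hsum H K -> H) @ F).
  by apply: cauchy_cvg; apply: cauchy_map => u v; exact: (hsum_norm1 (u - v)).
have cv2 : cvg ((snd : hsum H K -> K) @ F).
  by apply: cauchy_cvg; apply: cauchy_map => u v; exact: (hsum_norm2 (u - v)).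
apply/cvg_ex; exists ((lim ((fst : hsum H K -> H) @ F),
  lim ((snd : hsum H K -> K) @ F)) : hsum H K).
apply/cvgrPdist_lt => e e0.
have e20 : 0 < e / 2 by rewrite divr_gt0.
have /cvgrPdist_lt/(_ _ e20) c1 := cv1.
have /cvgrPdist_lt/(_ _ e20) c2 := cv2.
near=> u.
apply: le_lt_trans (hsum_norm_le _) _ => /=.
rewrite [e]splitr ltrD//; near: u; [exact: c1|exact: c2].
Unshelve. all: by end_near. Qed.

HB.instance Definition _ := Uniform_isComplete.Build (hsum H K) hsum_complete.

Definition hsum_dot u v : C := hdot u.1 v.1 + hdot u.2 v.2.

Let hsum_dot_bilinear :
  bilinear_for ( *%R : GRing.Scale.law C C) (Num.conj \; *%R : GRing.Scale.law C C)
    hsum_dot.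
Proof.
split=> [v a u w|u a v w]; rewrite /hsum_dot /=.
  by rewrite !linearPl /= mulrDr addrACA.
by rewrite !linearPr /= mulrDr addrACA.
Qed.

HB.instance Definition _ := bilinear_isBilinear.Build C (hsum H K) (hsum H K) C
  *%R (Num.conj \; *%R) hsum_dot hsum_dot_bilinear.

Let hsum_dot_hermitian u v :
  hsum_dot u v = (-1) ^+ false * Num.conj (hsum_dot v u).
Proof.
by rewrite /hsum_dot expr0 mul1r rmorphD/= (hermC (hdot : {dot H for _}) u.1)
  (hermC (hdot : {dot K for _}) u.2) !expr0 !mul1r.
Qed.

HB.instance Definition _ := isHermitianSesquilinear.Build C (hsum H K) false
  Num.conj hsum_dot hsum_dot_hermitian.

Let hsum_dotE u : hsum_dot u u = `|u| ^+ 2.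
Proof. by rewrite /hsum_dot !hdotE hsum_normE sqrtCK. Qed.

Let hsum_dot_gt0 u : u != 0 -> 0 < hsum_dot u u.
Proof. by move=> u0; rewrite hsum_dotE exprn_gt0// normr_gt0. Qed.

HB.instance Definition _ := isDotProduct.Build C (hsum H K) hsum_dot hsum_dot_gt0.

HB.instance Definition _ :=
  NormedModule_isInnerProduct.Build C (hsum H K) hsum_dotE.

End HilbertDirectSum.

Section LinearRelations.
Variable R : realType.
Implicit Types H K L X : hilbertType R[i].

(* A linear relation from [H] into [K] is represented by its graph. *)
Definition linear_relation H K (T : set (hsum H K)) : Prop :=
  submod_closed (mem T).

Definition CR H K : set (set (hsum H K)) :=
  [set T | linear_relation T /\ closed T].
Arguments CR : clear implicits.

Definition lr_dom H K (T : set (hsum H K)) : set H :=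
  [set x | exists y, T (x, y)].

Definition lr_ran H K (T : set (hsum H K)) : set K :=
  [set y | exists x, T (x, y)].

Definition lr_mul H K (T : set (hsum H K)) : set K := [set y | T (0, y)].

Definition lr_comp H K L (T : set (hsum K L)) (S : set (hsum H K)) :
    set (hsum H L) :=
  [set p | exists2 z, S (p.1, z) & T (z, p.2)].

Definition lr_shift X (T : set (hsum X X)) (lambda : R[i]) : set (hsum X X) :=
  [set (p.1, p.2 - lambda *: p.1) | p in T].

(* For a subspace [N] of [K], the elements of [K / N] are the cosets of [N],
   as sets. When [N] is closed, [quotient_norm] is the norm of [K / N]; norms
   have values in [R[i]], hence the [complex.Re]. *)
Definition quotient_map K (N : set K) (y : K) : set K := [set y + m | m in N].

Definition quotient_norm K (S : set K) : R :=
  inf [set complex.Re `|z| | z in S].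

(* The graph of the operator [Q_T T]. *)
Definition lr_quotient H K (T : set (hsum H K)) : set (H * set K) :=
  [set (p.1, quotient_map (closure (lr_mul T)) p.2) | p in T].

Definition lr_continuous H K (T : set (hsum H K)) : Prop :=
  exists c : R, forall (x : H) (S : set K),
    lr_quotient T (x, S) -> quotient_norm S <= c * complex.Re `|x|.

Definition BCR H K : set (set (hsum H K)) :=
  [set T | [/\ linear_relation T, lr_continuous T & lr_dom T = setT]].
Arguments BCR : clear implicits.

(* [K / N] is spanned by finitely many cosets. *)
Definition finite_codim K (N : set K) : Prop :=
  exists (n : nat) (v : 'I_n -> K), forall y : K,
    exists a : 'I_n -> R[i], N (y - \sum_(i < n) a i *: v i).

Definition phi_minus H K : set (set (hsum H K)) :=
  [set T | [/\ CR H K T, closed (lr_ran T) & finite_codim (lr_ran T)]].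
Arguments phi_minus : clear implicits.

Definition sigma_e2 X (T : set (hsum X X)) : set R[i] :=
  [set lambda | ~ phi_minus X X (lr_shift T lambda)].

(* The relation [0 A; B 0]. *)
Definition lr_antidiag H K (A : set (hsum K H)) (B : set (hsum H K)) :
    set (hsum (hsum H K) (hsum H K)) :=
  [set p | let: ((x, y), (ya, xb)) := p in B (x, xb) /\ A (y, ya)].

End LinearRelations.

Arguments CR {R} H K.
Arguments BCR {R} H K.
Arguments phi_minus {R} H K.

(* Main.v *)
From HB Require Import structures.
Require Import Defs.
From mathcomp Require Import all_boot all_order all_algebra.
From mathcomp Require Import ring lra.
From mathcomp Require Import complex.
From mathcomp Require Import all_classical all_reals all_analysis.

(** Write [T] for the antidiagonal relation. Everything rests on the fact that
the range of a closed linear relation between Hilbert spaces is closed as soon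
as it has finite codimension ([finite_codim_closed_range]). Since [T], [AB],
[BA] and their shifts are closed, membership in the class [phi_minus] becomes
a purely algebraic question about codimensions ([phi_minusP]), and the theorem
reduces to: [R(T - l)] has finite codimension if and only if both
[R(AB - l^2)] and [R(BA - l^2)] have.

The relation [T^2] is the direct sum of [AB] and [BA], and
[T^2 - l^2 = (T - l)(T + l)], which gives
[R((T - l)(T + l)) c R(AB - l^2) x R(BA - l^2) c R(T - l)]
([ran_antidiag_sqr_sub] and [ran_sqr_sub_antidiag]).
The second inclusion settles one direction. For the other one, the symmetry
[(x, y) |-> (x, - y)] turns [T] into [- T], so that [R(T + l)] has finite
codimension along with [R(T - l)]; as [T - l] is defined everywhere, it maps
[R(T + l)] onto a subspace of finite codimension of [R(T - l)], and the first
inclusion applies.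

For the closed range property, suppose that the range of a closed relation [G]
together with [v_1, ..., v_n] spans the whole space. Directions outside the range
are added to [G] one at a time, the line through [v_i] becoming an extra direct
summand of the domain, until a surjective closed relation is obtained. By the open
mapping theorem (Baire and successive approximation) it has a bounded
right inverse, and this property comes back down to [G] because each added
line meets the previous range trivially ([complement_bounded_right_inverse]).
Finally a closed relation with a bounded right inverse has closed range,
again by successive approximation. This analytic part takes place in real
Banach spaces; a complex Hilbert space is viewed as one through [realified]. *)

Set Implicit Arguments.
Unset Strict Implicit.
Unset Printing Implicit Defensive.

Import Order.TTheory GRing.Theory Num.Theory.
Import numFieldNormedType.Exports.

Local Open Scope classical_set_scope.
Local Open Scope ring_scope.

(** * Linear subspaces as sets *)

Definition linear_subspace (F : pzRingType) (V : lmodType F) (S : set V) : Prop :=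
  S 0 /\ forall a u v, S u -> S v -> S (a *: u + v).

Lemma linear_subspaceB (F : pzRingType) (V : lmodType F) (S : set V) u v :
  linear_subspace S -> S u -> S v -> S (u - v).
Proof. by move=> [_ SS] Su Sv; rewrite addrC -scaleN1r; exact: SS. Qed.

Lemma linear_subspaceD (F : pzRingType) (V : lmodType F) (S : set V) u v :
  linear_subspace S -> S u -> S v -> S (u + v).
Proof. by move=> [_ SS] Su Sv; rewrite -[u]scale1r; exact: SS. Qed.

Lemma linear_subspaceZ (F : pzRingType) (V : lmodType F) (S : set V) a u :
  linear_subspace S -> S u -> S (a *: u).
Proof. by move=> [S0 SS] Su; rewrite -[_ *: _]addr0; exact: SS. Qed.

Lemma linear_subspace_sum (F : pzRingType) (V : lmodType F) (S : set V) n
    (f : 'I_n -> V) : linear_subspace S -> (forall i, S (f i)) -> S (\sum_i f i).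
Proof.
move=> SS Sf; elim/big_ind: _ => //; first exact: SS.1.
by move=> u v; exact: linear_subspaceD.
Qed.

Lemma range_subspace (F : pzRingType) (V W : lmodType F) (G : set (V * W)) :
  linear_subspace G -> linear_subspace [set w | exists x, G (x, w)].
Proof.
move=> [G0 GS]; split; first by exists 0.
by move=> a u v [x Gx] [y Gy]; exists (a *: x + y); exact: (GS a (x, u) (y, v)).
Qed.

(** * Closed linear relations between real Banach spaces *)

Section Banach.
Variables (R : realType) (X W : completeNormedModType R).
Implicit Types (G : set (X * W)) (S : set W).

(** If every [w] in [S] can be hit by [G] up to an error of half its norm, at
cost [c * `|w|], then correcting the error again and again produces two
geometric series: the residuals tend to [0], the corrections sum to an exact
preimage of norm at most [c * (1 + 1/2 + 1/4 + ...)] times [`|w|]. The set [S] is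
the whole space for the open mapping theorem, and the closure of the range for
the closed range criterion. *)
Lemma successive_approximation G S (c : R) :
  0 <= c -> linear_subspace G -> closed G -> linear_subspace S ->
  (forall x w, G (x, w) -> S w) ->
  (forall w, S w -> exists x w',
     [/\ G (x, w'), `|x| <= c * `|w| & `|w - w'| <= `|w| / 2]) ->
  forall w, S w -> exists2 x, G (x, w) & `|x| <= 2 * c * `|w|.
Proof.
move=> c0 Gsub Gcl Ssub GS approx w Sw.
have [f fP] : exists f : W -> X * W, forall w, S w ->
    [/\ G (f w), `|(f w).1| <= c * `|w| & `|w - (f w).2| <= `|w| / 2].
  suff /choice[f fP] : forall w, exists p : X * W, S w ->
      [/\ G p, `|p.1| <= c * `|w| & `|w - p.2| <= `|w| / 2] by exists f.
  move=> v; have [Sv|nSv] := pselect (S v); last by exists 0.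
  by have [x [w' H]] := approx _ Sv; exists (x, w').
(* [r k] is the residual after [k] corrections. *)
pose r := fix r k := if k is k'.+1 then r k' - (f (r k')).2 else w.
have Sr k : S (r k).
  elim: k => //= k IH; apply: linear_subspaceB => //.
  by have [+ _ _] := fP _ IH; case: (f _) => x y /GS.
have r_le k : `|r k| <= `|w| * 2^-1 ^+ k.
  elim: k => [|k IH]; first by rewrite expr0 mulr1.
  have [_ _ /le_trans] := fP _ (Sr k); apply.
  by rewrite exprSr mulrA ler_wpM2r.
have c0w : 0 <= c * `|w| by rewrite mulr_ge0.
pose u k := (f (r k)).1.
have u_le k : `|u k| <= geometric (c * `|w|) 2^-1 k.
  have [_ + _] := fP _ (Sr k) => /le_trans; apply.
  by rewrite /geometric /= -mulrA ler_wpM2l.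
have half1 : `|2^-1 : R| < 1 by rewrite ger0_norm ?invf_lt1 ?ltr1n.
have cvg_geo := @is_cvg_geometric_series _ (c * `|w|) _ half1.
have cvg_nu : cvgn [normed series u].
  apply: series_le_cvg u_le cvg_geo => // n.
  by rewrite /geometric /= mulr_ge0// exprn_ge0.
have cvg_u := normed_cvg cvg_nu.
exists (limn (series u)).
  (* The partial sum is an exact preimage of what has been removed from [w]. *)
  have Gpart n : G (series u n, w - r n).
    elim: n => [|n IH]; first by rewrite /series /= big_geq// subrr; exact: Gsub.1.
    have [Gf _ _] := fP _ (Sr n).
    rewrite seriesSr /= opprB addrCA [_ + (w - _)]addrC.
    have -> : ((series u n + u n, w - r n + (f (r n)).2) : X * W) =
       (series u n, w - r n) + f (r n) by rewrite /u; case: (f _).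
    exact: linear_subspaceD.
  have cvg_r : r @ \oo --> (0 : W).
    apply/norm_cvg0P.
    apply: (@squeeze_cvgr _ _ _ _ (fun=> 0) (geometric `|w| 2^-1)).
    - by apply: nearW => n; rewrite normr_ge0 /=; exact: r_le.
    - exact: cvg_cst.
    - exact: cvg_geometric.
  apply: (@closed_cvg _ _ \oo _ (fun n => (series u n, w - r n))) Gcl _ _ _.
    exact: nearW.
  apply: cvg_pair; first exact: cvg_u.
  by rewrite -[in X in _ --> X](subr0 w); apply: cvgB => //; exact: cvg_cst.
apply: le_trans (lim_series_norm cvg_nu) _.
apply: le_trans (lim_series_le cvg_nu cvg_geo u_le) _.
rewrite (cvg_lim _ (@cvg_geometric_series _ (c * `|w|) _ half1))//.
by rewrite le_eqVlt; apply/orP; left; apply/eqP; field.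
Qed.

Lemma near_closure S w e : closure S w -> 0 < e -> exists2 w', S w' & `|w - w'| < e.
Proof.
move=> clS e0; have [w' [Sw' ww']] := clS _ (nbhsx_ballx w e e0).
by exists w' => //; move: ww'; rewrite -ball_normE.
Qed.

Lemma closure_subspace S : linear_subspace S -> linear_subspace (closure S).
Proof.
move=> Ssub; split; first exact/subset_closure/Ssub.1.
move=> a u v clu clv B /nbhs_ballP[e /= e0 eB].
have a1 : 0 < `|a| + 1 by rewrite ltr_wpDl.
have e2 : 0 < e / 2 by rewrite divr_gt0.
have e2a : 0 < e / 2 / (`|a| + 1) by rewrite divr_gt0.
have [u' Su' uu'] := near_closure clu e2a.
have [v' Sv' vv'] := near_closure clv e2.
exists (a *: u' + v'); split; first exact: Ssub.2.
apply: eB; rewrite -ball_normE /ball_ /= opprD addrACA -scalerBr.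
rewrite (le_lt_trans (ler_normD _ _))// [e]splitr ler_ltD// normrZ.
rewrite (@le_trans _ _ ((`|a| + 1) * (e / 2 / (`|a| + 1))))//.
  by rewrite ler_pM// ?ltW// ltrDl.
by rewrite mulrC divfK// gt_eqF.
Qed.

(** The sets [E n] of points with a preimage of norm at most [n] cover [W], so by
Baire some closure of [E n] contains a ball. Differences of two points of that
ball cover a ball around [0], hence every vector has, up to small
error, a preimage of comparable norm. *)
Lemma open_mapping G : linear_subspace G -> closed G ->
  (forall w, exists x, G (x, w)) ->
  exists c, forall w, exists2 x, G (x, w) & `|x| <= c * `|w|.
Proof.
move=> Gsub Gcl surj.
pose E n := [set w | exists2 x, G (x, w) & `|x| <= n%:R].
have [n [w0 [e e0 ballE]]] :
    exists n w0, exists2 e : R, 0 < e & ball w0 e `<=` closure (E n).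
  apply: contrapT => nE.
  have : dense (\bigcap_n (~` closure (E n))).
    apply: Baire => n; split; first exact/closed_openC/closed_closure.
    apply: contrapT => /denseNE[D [[w [Dopen Dw]] DE]]; apply: nE.
    have /nbhs_ballP[e /= e0 eD] := open_nbhs_nbhs (conj Dopen Dw).
    exists n, w, e => // z /eD Dz; apply: contrapT => nz.
    by have : (D `&` ~` closure (E n)) z by []; rewrite DE.
  move=> /(_ setT _ openT)[]; first by exists 0.
  move=> w [_ nw]; have [x Gx] := surj w.
  apply: (nw (Num.truncn `|x|).+1 Logic.I); apply: subset_closure; exists x => //.
  by apply/ltW/truncnS_gt.
pose k := 4 * n%:R / e.
have k0 : 0 <= k by rewrite /k divr_ge0 ?mulr_ge0// ltW.
exists (2 * k).
suff H w : exists x w', [/\ G (x, w'), `|x| <= k * `|w| & `|w - w'| <= `|w| / 2].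
  by move=> w; apply: (@successive_approximation G setT k).
have [->|wn0] := eqVneq w 0.
  by exists 0, 0; rewrite subrr !normr0 mulr0 mul0r; split => //; exact: Gsub.1.
have nw0 : 0 < `|w| by rewrite normr_gt0.
(* [t] scales [w] to half the radius of the ball, so that [w0 + t *: w] stays in it. *)
pose t := e / 2 / `|w|.
have t0 : 0 < t by rewrite !divr_gt0.
have tw : t * `|w| = e / 2 by rewrite /t divfK// gt_eqF.
have cl0 : closure (E n) w0 by apply: ballE; exact: ballxx.
have cl1 : closure (E n) (t *: w + w0).
  apply: ballE; rewrite -ball_normE /ball_ /= opprD addrCA subrr addr0 normrN.
  by rewrite normrZ gtr0_norm// tw ltr_pdivrMr// mulr_natr mulr2n ltrDl.
(* Two errors of [e / 8] add up to half the norm of [t *: w]. *)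
have e8 : 0 < e / 8 by rewrite divr_gt0.
have [z0 [x0 Gx0 x0n] wz0] := near_closure cl0 e8.
have [z1 [x1 Gx1 x1n] wz1] := near_closure cl1 e8.
exists (t^-1 *: (x1 - x0)), (t^-1 *: (z1 - z0)); split.
- exact: (linear_subspaceZ t^-1 Gsub (linear_subspaceB Gsub Gx1 Gx0)).
- rewrite normrZ gtr0_norm ?invr_gt0// ler_pdivrMl//.
  have -> : t * (k * `|w|) = n%:R + n%:R.
    by rewrite mulrCA tw /k; field; rewrite gt_eqF.
  by rewrite (le_trans (ler_normB _ _))// lerD.
- rewrite -(ler_pM2l t0) mulrA tw -{1}(gtr0_norm t0) -normrZ scalerBr.
  rewrite scalerA divff ?gt_eqF// scale1r.
  have -> : t *: w - (z1 - z0) = (t *: w + w0 - z1) - (w0 - z0).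
    by rewrite !opprB (addrAC _ w0) addrACA subrr addr0 -addrA (addrC z0).
  by rewrite (le_trans (ler_normB _ _))//; lra.
Qed.

(** A point [w] of the closure of the range is within half its norm of some
[w'] in the range, and [w'] has a preimage of norm at most [c * `|w'|]; so [w]
itself is in the range, by successive approximation. *)
Lemma closed_range G (c : R) : linear_subspace G -> closed G ->
  (forall x w, G (x, w) -> exists2 x', G (x', w) & `|x'| <= c * `|w|) ->
  closed [set w | exists x, G (x, w)].
Proof.
move=> Gsub Gcl bnd.
set N := [set w | _].
have c0 : 0 <= 2 * `|c| by rewrite mulr_ge0.
suff H w : closure N w -> exists x w',
    [/\ G (x, w'), `|x| <= 2 * `|c| * `|w| & `|w - w'| <= `|w| / 2].
  move=> w Nw.
  have Ssub : linear_subspace (closure N).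
    exact: closure_subspace (range_subspace Gsub).
  have GS x v : G (x, v) -> closure N v by move=> Gx; apply: subset_closure; exists x.
  have [x Gx _] := successive_approximation c0 Gsub Gcl Ssub GS H Nw.
  by exists x.
move=> clw.
have [->|wn0] := eqVneq w 0.
  by exists 0, 0; rewrite subrr !normr0 mulr0 mul0r; split => //; exact: Gsub.1.
have nw0 : 0 < `|w| / 2 by rewrite divr_gt0 ?normr_gt0.
have [w' [x0 /bnd[x Gx xc]] ww'] := near_closure clw nw0.
exists x, w'; split => //; last exact: ltW.
rewrite (le_trans xc)//.
have w'w : `|w'| <= 2 * `|w|.
  have := ler_normB w (w - w'); rewrite opprB addrCA subrr addr0 => /le_trans; apply.
  by lra.
rewrite [2 * _]mulrC -mulrA (le_trans (ler_wpM2r _ (ler_norm c)))//.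
by rewrite ler_wpM2l.
Qed.

End Banach.

(** * A complex Hilbert space as a real Banach space *)

(** The same vectors with real scalars and a real-valued norm, so that Baire's
theorem and the summation of normally convergent series apply. *)
Definition realified (R : realType) (V : hilbertType R[i]) : Type := V.

Section Realified.
Local Open Scope complex_scope.
Variables (R : realType) (V : hilbertType R[i]).

HB.instance Definition _ := GRing.Zmodule.copy (realified V) V.

Definition realified_scale (a : R) (x : realified V) : realified V :=
  a%:C *: (x : V).

Let scaleA a b x : realified_scale a (realified_scale b x) = realified_scale (a * b) x.
Proof. by rewrite /realified_scale scalerA -rmorphM. Qed.

Let scale1 : left_id 1 realified_scale.
Proof. by move=> x; rewrite /realified_scale rmorph1 scale1r. Qed.

Let scaleDr : right_distributive realified_scale +%R.
Proof. by move=> a x y; rewrite /realified_scale scalerDr. Qed.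

Let scaleDl x : {morph realified_scale^~ x : a b / a + b}.
Proof. by move=> a b; rewrite /realified_scale rmorphD scalerDl. Qed.

HB.instance Definition _ := GRing.Zmodule_isLmodule.Build R (realified V)
  scaleA scale1 scaleDr scaleDl.

Definition realified_norm (x : realified V) : R := complex.Re `|x : V|.

Lemma realified_normE (x : V) : `|x| = (realified_norm x)%:C.
Proof. by rewrite /realified_norm RRe_real// normr_real. Qed.

Let normD x y : realified_norm (x + y) <= realified_norm x + realified_norm y.
Proof. by rewrite -lecR rmorphD/= -!realified_normE; exact: (@ler_normD _ V). Qed.

Let normZ (a : R) x : realified_norm (a *: x) = `|a| * realified_norm x.
Proof.
apply: complexI; rewrite rmorphM/= -!realified_normE normrZ; congr (_ * _).
by rewrite normc_def/= expr0n addr0 sqrtr_sqr.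
Qed.

Let norm0_eq0 x : realified_norm x = 0 -> x = 0.
Proof. by move=> x0; apply: (@normr0_eq0 _ V); rewrite realified_normE x0. Qed.

HB.instance Definition _ := Lmodule_isNormed.Build R (realified V) normD normZ norm0_eq0.

Lemma realified_continuous : continuous (fun x : V => x : realified V).
Proof.
move=> x; apply/cvgrPdist_lt => e e0.
have eC : 0 < e%:C by rewrite ltcR.
apply: filterS (nbhsx_ballx (x : V) _ eC) => y; rewrite -ball_normE /ball_ /=.
by rewrite -ltcR -realified_normE.
Qed.

Lemma unrealified_continuous : continuous (fun x : realified V => x : V).
Proof.
move=> x A /nbhs_ballP[e /= e0 eA].
have eR : e = (complex.Re e)%:C by rewrite RRe_real// gtr0_real.
have e'0 : 0 < complex.Re e by rewrite -ltcR -eR.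
apply/nbhs_ballP; exists (complex.Re e) => //= y xy; apply: eA; move: xy.
by rewrite -!ball_normE /ball_ /= {2}eR realified_normE ltcR.
Qed.

Let complete (F : set_system (realified V)) : ProperFilter F -> cauchy F -> cvg F.
Proof.
move=> FF /cauchy_ballP Fc.
suff /cauchy_cvg/cvg_ex[l Fl] : cauchy (F : set_system V).
  by apply/cvg_ex; exists l => A /realified_continuous; exact: Fl.
apply/cauchy_ballP => e e0.
have eR : e = (complex.Re e)%:C by rewrite RRe_real// gtr0_real.
have e'0 : 0 < complex.Re e by rewrite -ltcR -eR.
apply: filterS (Fc _ e'0) => -[u v] /=; rewrite -!ball_normE /ball_ /=.
by rewrite eR realified_normE ltcR.
Qed.

HB.instance Definition _ := Uniform_isComplete.Build (realified V) complete.

End Realified.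

(** * The closed range property between complex Hilbert spaces *)

Section Transfer.
Variable R : realType.
Implicit Types V W X : hilbertType R[i].

Lemma hsum_pair_continuous (T : topologicalType) V W (f : T -> V) (g : T -> W) :
  continuous f -> continuous g -> continuous (fun t => (f t, g t) : hsum V W).
Proof.
move=> fc gc t; apply/cvgrPdist_lt => e e0.
have e2 : 0 < e / 2 by rewrite divr_gt0.
near=> u; apply: le_lt_trans (hsum_norm_le _) _ => /=.
rewrite [e]splitr ltrD//; near: u.
  by have /cvgrPdist_lt := fc t; exact.
by have /cvgrPdist_lt := gc t; exact.
Unshelve. all: by end_near. Qed.

Lemma hsum_fst_continuous V W : continuous (fun p : hsum V W => p.1).
Proof.
move=> p A /nbhs_ballP[e /= e0 eA]; apply/nbhs_ballP; exists e => //= q pq.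
apply: eA; move: pq; rewrite -!ball_normE /ball_ /=.
exact: le_lt_trans (hsum_norm1 (p - q)).
Qed.

Lemma hsum_snd_continuous V W : continuous (fun p : hsum V W => p.2).
Proof.
move=> p A /nbhs_ballP[e /= e0 eA]; apply/nbhs_ballP; exists e => //= q pq.
apply: eA; move: pq; rewrite -!ball_normE /ball_ /=.
exact: le_lt_trans (hsum_norm2 (p - q)).
Qed.

Lemma continuous_hsum1 (T : topologicalType) V W (f : T -> hsum V W) :
  continuous f -> continuous (fun t => (f t).1).
Proof.
move=> fc t.
exact: (@continuous_comp _ _ _ f _ t (fc t) (@hsum_fst_continuous V W (f t))).
Qed.

Lemma continuous_hsum2 (T : topologicalType) V W (f : T -> hsum V W) :
  continuous f -> continuous (fun t => (f t).2).
Proof.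
move=> fc t.
exact: (@continuous_comp _ _ _ f _ t (fc t) (@hsum_snd_continuous V W (f t))).
Qed.

Lemma continuous_sub (T : topologicalType) W (f g : T -> W) :
  continuous f -> continuous g -> continuous (fun t => f t - g t).
Proof. by move=> fc gc t; apply: cvgB; [exact: fc|exact: gc]. Qed.

Lemma continuous_addZ (T : topologicalType) W (f g : T -> W) (a : R[i]) :
  continuous f -> continuous g -> continuous (fun t => f t + a *: g t).
Proof.
move=> fc gc t; apply: cvgD; first exact: fc.
by apply: cvgZ; [exact: cvg_cst|exact: gc].
Qed.

Lemma closed_preimage (S T : topologicalType) (f : S -> T) (A : set T) :
  continuous f -> closed A -> closed [set x | A (f x)].
Proof. by move=> fc; apply: closed_comp => x _; exact: fc. Qed.

Lemma linear_relationP V W (T : set (hsum V W)) : linear_relation T <-> linear_subspace T.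
Proof.
split=> -[T0 TS]; split.
- by have := T0; rewrite inE.
- by move=> a u v Tu Tv; have := TS a u v; rewrite !inE; exact.
- by rewrite inE.
- by move=> a u v; rewrite !inE; exact: TS.
Qed.

Lemma realified_relation V W (T : set (hsum V W)) : CR V W T ->
  linear_subspace (T : set (realified V * realified W)) /\
  closed (T : set (realified V * realified W)).
Proof.
move=> [/linear_relationP[T0 TS] Tcl]; split.
  by split=> // a u v; exact: TS.
pose f (p : realified V * realified W) : hsum V W := (p.1, p.2).
have -> : T = [set p | T (f p)] by apply/seteqP; split=> -[].
apply: closed_preimage Tcl; apply: hsum_pair_continuous => p.
  apply: (@continuous_comp _ _ _ fst (fun x : realified V => x : V)).
    exact: cvg_fst.
  exact: unrealified_continuous.
apply: (@continuous_comp _ _ _ snd (fun x : realified W => x : W)).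
  exact: cvg_snd.
exact: unrealified_continuous.
Qed.

(** The norms are taken through [complex.Re] so that this is the estimate given
by the open mapping theorem for the [realified] spaces. *)
Definition bounded_right_inverse V W (T : set (hsum V W)) :=
  exists c : R, forall x w, T (x, w) ->
    exists2 x', T (x', w) & complex.Re `|x'| <= c * complex.Re `|w|.

Lemma surjective_bounded_right_inverse V W (T : set (hsum V W)) :
  CR V W T -> lr_ran T = setT -> bounded_right_inverse T.
Proof.
move=> /realified_relation[Tsub Tcl] surj.
have [|c cP] := open_mapping Tsub Tcl.
  by move=> w; have : lr_ran T w by rewrite surj.
by exists c => x w _; exact: cP.
Qed.

Lemma bounded_right_inverse_closed V W (T : set (hsum V W)) :
  CR V W T -> bounded_right_inverse T -> closed (lr_ran T).
Proof.
move=> /realified_relation[Tsub Tcl] [c cP].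
have := closed_range Tsub Tcl cP.
exact: (closed_preimage (@realified_continuous R W)).
Qed.

(** With [p = (s, v) / (v, v)], Pythagoras shows that [p *: v] is the point of
the line nearest to [s]; if [s] is in the closure the distance is [0]. *)
Lemma closed_line V (v : V) : closed [set s | exists a : R[i], s = a *: v].
Proof.
have [->|v0] := eqVneq v 0.
  have -> : [set s : V | exists a : R[i], s = a *: 0] = [set 0].
    apply/seteqP; split=> s; first by move=> [a ->]; rewrite scaler0.
    by move=> ->; exists 0; rewrite scaler0.
  exact/accessible_closed_set1/hausdorff_accessible/norm_hausdorff.
move=> s cls.
pose p := hdot s v / hdot v v.
exists p; apply/eqP; rewrite -subr_eq0 -normr_eq0; apply: contrapT => /negP d0.
have dpos : 0 < `|s - p *: v| by rewrite lt_def d0 normr_ge0.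
have [_ [[a ->] sa]] := cls _ (nbhsx_ballx s _ dpos).
suff le_dist : `|s - p *: v| <= `|s - a *: v|.
  by move: sa; rewrite -ball_normE /ball_ /= => /(le_lt_trans le_dist); rewrite ltxx.
rewrite -ler_sqr ?nnegrE//.
have orth : hdot (s - p *: v) ((p - a) *: v) = 0.
  rewrite linearZr_LR linearBl linearZl_LR /= /p divfK ?subrr ?mulr0//.
  by rewrite hdotE expf_neq0// normr_eq0.
have <- : (s - p *: v) + (p - a) *: v = s - a *: v by rewrite scalerBl addrA subrK.
by rewrite -[leRHS]hdotE hnormDd//= !hdotE lerDl exprn_ge0.
Qed.

End Transfer.

Lemma lr_ran_subspace (R : realType) (V W : hilbertType R[i])
    (T : set (hsum V W)) : linear_subspace T -> linear_subspace (lr_ran T).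
Proof. exact: (@range_subspace _ V W). Qed.

Lemma pair_mem (V W : Type) (T : set (V * W)) (p : V * W) x y :
  T p -> p.1 = x -> p.2 = y -> T (x, y).
Proof. by case: p => a b /= + <- <-. Qed.

(** Induction on the number of vectors completing the range. If [v ord0] is in
the range already, it can be dropped. Otherwise the relation is enlarged to [T'],
relating [(x, s)] to [y + s] when [T] relates [x] to [y] and [s] is on the line
of [v ord0]; it is closed and needs one vector less. A bounded preimage
[(x, s)] under [T'] of a point of the range of [T] has [s = 0], since the line
meets that range in [0] only, so [x] is a bounded preimage under [T]. The
domain [V] varies in the induction. *)
Lemma complement_bounded_right_inverse (R : realType) (W : hilbertType R[i]) n :
  forall (V : hilbertType R[i]) (T : set (hsum V W)) (v : 'I_n -> W), CR V W T ->
  (forall y, exists a : 'I_n -> R[i], lr_ran T (y - \sum_(i < n) a i *: v i)) ->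
  bounded_right_inverse T.
Proof.
elim: n => [|n IH] V T v TCR span.
  apply: surjective_bounded_right_inverse => //; apply/seteqP; split=> // y _.
  by have [a] := span y; rewrite big_ord0 subr0.
have [/linear_relationP Tsub Tcl] := TCR.
have Rsub := lr_ran_subspace Tsub.
have [Tv|nTv] := pselect (lr_ran T (v ord0)).
  apply: (IH _ _ (v \o lift ord0)) => // y.
  have [a Ta] := span y; exists (a \o lift ord0).
  have -> : y - \sum_(i < n) (a \o lift ord0) i *: (v \o lift ord0) i =
      a ord0 *: v ord0 + (y - \sum_(i < n.+1) a i *: v i).
    by rewrite big_ord_recl opprD (addrCA y) addNKr.
  exact: Rsub.2.
pose T' : set (hsum (hsum V W) W) := [set p |
  T (p.1.1, p.2 - p.1.2) /\ exists a : R[i], p.1.2 = a *: v ord0].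
have T'CR : CR _ _ T'.
  split.
    apply/linear_relationP; split.
      split=> /=.
        by rewrite subr0; exact: Tsub.1.
      by exists 0; rewrite scale0r.
    move=> b [[x s] y] [[x' s'] y'] [/= Txy [a sE]] [/= Tx'y' [a' s'E]].
    split=> /=; last by exists (b * a + a'); rewrite sE s'E scalerDl scalerA.
    apply: (pair_mem (Tsub.2 b _ _ Txy Tx'y')) => //=.
    by rewrite scalerBr opprD addrACA.
  have cts1 := @hsum_fst_continuous R (hsum V W) W.
  have cts2 := @hsum_snd_continuous R (hsum V W) W.
  apply: (@closedI _ [set p : hsum (hsum V W) W | T (p.1.1, p.2 - p.1.2)]).
    apply: (closed_preimage (f := fun p : hsum (hsum V W) W =>
      (p.1.1, p.2 - p.1.2) : hsum V W)) => //.
    apply: hsum_pair_continuous; first exact: continuous_hsum1.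
    by apply: continuous_sub => //; exact: continuous_hsum2.
  exact: (@closed_preimage _ _ _ [set s | exists a : R[i], s = a *: v ord0]
    (continuous_hsum2 cts1) (@closed_line R _ (v ord0))).
have [|c cP] := IH _ _ (v \o lift ord0) T'CR.
  move=> y; have [a [x Tx]] := span y; exists (a \o lift ord0).
  exists (x, a ord0 *: v ord0); split => /=; last by exists (a ord0).
  by move: Tx; rewrite big_ord_recl opprD addrA addrAC.
exists c => x w Txw.
have T'xw : T' ((x, 0), w) by split=> /=; [rewrite subr0|exists 0; rewrite scale0r].
have [[x' s] [/= Tx's [a sE]] le_c] := cP _ _ T'xw.
have s0 : s = 0.
  rewrite sE; have [->|a0] := eqVneq a 0; first by rewrite scale0r.
  exfalso; apply: nTv; rewrite -(scalerK a0 (v ord0)) -sE.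
  apply: (linear_subspaceZ _ Rsub).
  have -> : s = w - (w - s) by rewrite opprB addrCA subrr addr0.
  by apply: linear_subspaceB => //; [exists x|exists x'].
move: Tx's le_c; rewrite s0 subr0 => Tx' le_c; exists x' => //.
apply: le_trans le_c.
by have := @hsum_norm1 _ V W (x', 0); rewrite lecE => /andP[].
Qed.

(** False for an arbitrary subspace of finite codimension (the kernel of a
discontinuous functional): that the range comes from a closed relation enters
through the open mapping theorem. *)
Lemma finite_codim_closed_range (R : realType) (V W : hilbertType R[i])
  (T : set (hsum V W)) : CR V W T -> finite_codim (lr_ran T) -> closed (lr_ran T).
Proof.
move=> TCR [n [v vP]]; apply: bounded_right_inverse_closed => //.
exact: complement_bounded_right_inverse vP.
Qed.

(** * Algebra of subspaces of finite codimension *)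

Section Algebra.
Variable R : realType.
Implicit Types V W H K X : hilbertType R[i].

Lemma finite_codimS W (N M : set W) :
  N `<=` M -> finite_codim N -> finite_codim M.
Proof.
move=> NM [n [v vP]]; exists n, v => y; have [a Na] := vP y.
by exists a; exact: NM.
Qed.

Lemma finite_codim_image V W (N : set V) (M : set W) (f : V -> W) (g : W -> V) :
  linear f -> (forall y, f (g y) = y) -> (forall x, N x -> M (f x)) ->
  finite_codim N -> finite_codim M.
Proof.
move=> flin gK NM [n [v vP]]; exists n, (f \o v) => y.
pose F : {linear V -> W} := HB.pack f (GRing.isLinear.Build _ _ _ _ f flin).
have [a Na] := vP (g y); exists a.
have -> : y - \sum_(i < n) a i *: (f \o v) i = F (g y - \sum_(i < n) a i *: v i).
  rewrite linearB [F (\sum_(i < n) _)]linear_sum [F (g y)](gK y).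
  by congr (y - _); apply: eq_bigr => i _; rewrite linearZ.
exact: NM.
Qed.

(** The hypothesis says that [N] and the [g j] together span at least [M]. *)
Lemma finite_codim_trans W (M N : set W) m (g : 'I_m -> W) :
  (forall y, M y -> exists b : 'I_m -> R[i], N (y - \sum_(i < m) b i *: g i)) ->
  finite_codim M -> finite_codim N.
Proof.
move=> MN [n [v vP]].
exists (n + m)%N.
exists (fun k => match fintype.split k with inl i => v i | inr j => g j end) => y.
have [a /MN[b Nab]] := vP y.
exists (fun k => match fintype.split k with inl i => a i | inr j => b j end).
rewrite big_split_ord /= opprD addrA.
under eq_bigr do rewrite (unsplitK (inl _)).
by under [X in _ - _ - X]eq_bigr do rewrite (unsplitK (inr _)).
Qed.

Lemma hsum_sum H K (I : finType) (x : I -> H) (y : I -> K) :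
  \sum_i ((x i, y i) : hsum H K) = (\sum_i x i, \sum_i y i).
Proof. by elim/big_rec3: _ => // i s p q _ ->. Qed.

Lemma finite_codim_setX H K (N : set H) (M : set K) :
  finite_codim N -> finite_codim M ->
  finite_codim ([set p | N p.1 /\ M p.2] : set (hsum H K)).
Proof.
move=> [n [u uP]] [m [v vP]].
apply: (@finite_codim_trans (hsum H K) [set p | N p.1] _ m (fun j => (0, v j))).
  move=> [x y] /= Nx; have [b Mb] := vP y; exists b.
  rewrite (hsum_sum (fun i => b i *: 0) (fun i => b i *: v i)) /=.
  by rewrite big1 ?subr0// => i _; rewrite scaler0.
exists n, (fun i => (u i, 0)) => -[x y]; have [a Na] := uP x; exists a.
by rewrite (hsum_sum (fun i => a i *: u i) (fun i => a i *: 0)).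
Qed.

(** If the vectors [v j] complete the range of [S], then any choice of images
[g j] of the [v j] under [T] completes [T(R(S))] to a subspace containing the
range of [T]. *)
Lemma finite_codim_comp H K L (T : set (hsum K L)) (S : set (hsum H K)) :
  linear_subspace T -> lr_dom T = setT ->
  finite_codim (lr_ran T) -> finite_codim (lr_ran S) ->
  finite_codim (lr_ran (lr_comp T S)).
Proof.
move=> Tsub Tdom Tfin [m [v vP]].
have /choice[g gP] : forall j, exists w, T (v j, w).
  by move=> j; have : lr_dom T (v j) by rewrite Tdom.
apply: (finite_codim_trans (g := g)) Tfin => w [z Tzw].
have [b [x Sx]] := vP z; exists b, x, (z - \sum_(i < m) b i *: v i) => //=.
have := linear_subspaceB Tsub Tzw
  (linear_subspace_sum Tsub (fun j => linear_subspaceZ (b j) Tsub (gP j))).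
by rewrite (hsum_sum (fun j => b j *: v j) (fun j => b j *: g j)).
Qed.

(** * Shifted relations and the antidiagonal relation *)

Lemma lr_shiftE X (T : set (hsum X X)) (l : R[i]) x y :
  lr_shift T l (x, y) <-> T (x, y + l *: x).
Proof.
split; first by move=> [[x' y'] Txy [<- <-]]; rewrite subrK.
by move=> Txy; exists (x, y + l *: x) => //=; rewrite addrK.
Qed.

Lemma CR_shift X (T : set (hsum X X)) (l : R[i]) : CR X X T -> CR X X (lr_shift T l).
Proof.
move=> [/linear_relationP[T0 TT] Tcl].
pose f (p : hsum X X) : hsum X X := (p.1, p.2 + l *: p.1).
have -> : lr_shift T l = [set p | T (f p)].
  by apply/seteqP; split=> -[x y] /lr_shiftE.
split.
  apply/linear_relationP; split; first by rewrite /= /f scaler0 addr0.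
  move=> a [x y] [x' y'] /= Tf Tf'; apply: (pair_mem (TT a _ _ Tf Tf')) => //=.
  by rewrite !scalerDr !scalerA (mulrC a) addrACA.
apply: closed_preimage Tcl; apply: hsum_pair_continuous.
  exact: hsum_fst_continuous.
by apply: continuous_addZ; [exact: hsum_snd_continuous|exact: hsum_fst_continuous].
Qed.

Lemma phi_minusP X (T : set (hsum X X)) (l : R[i]) : CR X X T ->
  phi_minus X X (lr_shift T l) <-> finite_codim (lr_ran (lr_shift T l)).
Proof.
move=> TCR; have TlCR := CR_shift l TCR; split=> [[]//|fin]; split=> //.
exact: finite_codim_closed_range.
Qed.

Section Antidiag.
Variables (H K : hilbertType R[i]) (A : set (hsum K H)) (B : set (hsum H K)).

Lemma CR_antidiag : CR K H A -> CR H K B -> CR _ _ (lr_antidiag A B).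
Proof.
move=> [/linear_relationP[A0 AA] Acl] [/linear_relationP[B0 BB] Bcl].
split.
  apply/linear_relationP; split; first by split.
  move=> a [[x y] [s t]] [[x' y'] [s' t']] [Bxt Ays] [Bxt' Ays'].
  by split; [exact: (BB a (x, t) (x', t'))|exact: (AA a (y, s) (y', s'))].
have -> : lr_antidiag A B = [set p | B (p.1.1, p.2.2)] `&` [set p | A (p.1.2, p.2.1)].
  by apply/seteqP; split=> -[[x y] [s t]].
have cts1 := @hsum_fst_continuous R (hsum H K) (hsum H K).
have cts2 := @hsum_snd_continuous R (hsum H K) (hsum H K).
apply: closedI.
  apply: closed_preimage Bcl; apply: hsum_pair_continuous.
    exact: continuous_hsum1.
  exact: continuous_hsum2.
apply: closed_preimage Acl; apply: hsum_pair_continuous.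
  exact: continuous_hsum2.
exact: continuous_hsum1.
Qed.

(** Half of [(T - l)(T + l) = T^2 - l^2], where [T^2] is the direct sum of [AB]
and [BA]: if [T + l] sends [(x, y)] to [(p, q)], then [B] relates [x] to
[q - l *: y], which is the intermediate point witnessing [AB] at [x]. *)
Lemma ran_antidiag_sqr_sub (l : R[i]) : linear_subspace A -> linear_subspace B ->
  lr_ran (lr_comp (lr_shift (lr_antidiag A B) l) (lr_shift (lr_antidiag A B) (- l)))
  `<=` [set p | lr_ran (lr_shift (lr_comp A B) (l ^+ 2)) p.1 /\
                lr_ran (lr_shift (lr_comp B A) (l ^+ 2)) p.2].
Proof.
move=> Asub Bsub [s t] [[x y] [[p q] /lr_shiftE[/= Bx Ay] /lr_shiftE[/= Bp Aq]]].
split.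
  exists x; apply/lr_shiftE; exists (q + - l *: y) => //=.
  apply: (pair_mem (linear_subspaceB Asub Aq (linear_subspaceZ l Asub Ay))) => /=.
    by rewrite scaleNr.
  by rewrite scalerDr scaleNr scalerN scalerA -expr2 opprB addrA addrAC addrK.
exists y; apply/lr_shiftE; exists (p + - l *: x) => //=.
apply: (pair_mem (linear_subspaceB Bsub Bp (linear_subspaceZ l Bsub Bx))) => /=.
  by rewrite scaleNr.
by rewrite scalerDr scaleNr scalerN scalerA -expr2 opprB addrA addrAC addrK.
Qed.

(** For [z] in [B x] and [r] in [A y], the vector [(l x + r, l y + z)] is an
image of [(x, y)] under [T + l]; applying [T - l] to it, the mixed terms [l z]
and [l r] cancel. *)
Lemma ran_sqr_sub_antidiag (l : R[i]) : linear_subspace A -> linear_subspace B ->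
  [set p | lr_ran (lr_shift (lr_comp A B) (l ^+ 2)) p.1 /\
           lr_ran (lr_shift (lr_comp B A) (l ^+ 2)) p.2]
  `<=` lr_ran (lr_shift (lr_antidiag A B) l).
Proof.
move=> Asub Bsub [u v] [[x /lr_shiftE[z /= Bxz Azs]] [y /lr_shiftE[r /= Ayr Brt]]].
exists (l *: x + r, l *: y + z); apply/lr_shiftE; split=> /=.
  apply: (pair_mem (Bsub.2 l _ _ Bxz Brt)) => //=.
  by rewrite scalerDr scalerA -expr2 [LHS]addrC addrA.
apply: (pair_mem (Asub.2 l _ _ Ayr Azs)) => //=.
by rewrite scalerDr scalerA -expr2 [LHS]addrC addrA.
Qed.

(** The symmetry [J (x, y) = (x, - y)] satisfies [J T J = - T], hence
[R(T + l) = J R(T - l)]. *)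
Lemma finite_codim_antidiag_opp (l : R[i]) : linear_subspace A -> linear_subspace B ->
  finite_codim (lr_ran (lr_shift (lr_antidiag A B) l)) ->
  finite_codim (lr_ran (lr_shift (lr_antidiag A B) (- l))).
Proof.
move=> Asub Bsub.
pose J (p : hsum H K) : hsum H K := (p.1, - p.2).
apply: (@finite_codim_image _ _ _ _ J J).
- by move=> a u v; congr pair => /=; rewrite opprD scalerN.
- by case=> x y; rewrite /J /= opprK.
move=> [s t] [[x y] /lr_shiftE[/= Bx Ay]].
exists (- x, y); apply/lr_shiftE; split => /=.
  apply: (pair_mem (linear_subspaceZ (-1) Bsub Bx)) => /=.
    by rewrite scaleN1r.
  by rewrite scaleN1r opprD scaleNr.
by apply: (pair_mem Ay) => //=; rewrite scaleNr scalerN opprK.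
Qed.

End Antidiag.
End Algebra.

Unset Implicit Arguments.

Theorem theorem4p6 (R : realType) (H K : hilbertType R[i])
    (A : set (hsum K H)) (B : set (hsum H K))
    (hA : (CR K H `&` BCR K H) A)
    (hB : (CR H K `&` BCR H K) B)
    (hAB : CR H H (lr_comp A B))
    (hBA : CR K K (lr_comp B A)) :
  sigma_e2 (lr_antidiag A B) =
  [set lambda | (sigma_e2 (lr_comp A B) `|` sigma_e2 (lr_comp B A))
                  (lambda ^+ 2)].
Proof.
have [[ACR [_ _ domA]] [BCR [_ _ domB]]] := (hA, hB).
have [[/linear_relationP Asub _] [/linear_relationP Bsub _]] := (ACR, BCR).
have TCR := CR_antidiag ACR BCR.
suff codimE l : finite_codim (lr_ran (lr_shift (lr_antidiag A B) l)) <->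
    finite_codim (lr_ran (lr_shift (lr_comp A B) (l ^+ 2))) /\
    finite_codim (lr_ran (lr_shift (lr_comp B A) (l ^+ 2))).
  apply/seteqP; split=> l; rewrite /sigma_e2 /= !phi_minusP//.
    by move=> /codimE/not_andP.
  by move=> /not_andP nfin /codimE.
split=> [fin|[finAB finBA]]; last first.
  apply: (@finite_codimS _ (hsum H K) _ _ (ran_sqr_sub_antidiag Asub Bsub)).
  exact: finite_codim_setX.
pose T l := lr_shift (lr_antidiag A B) l.
have TlCR : linear_subspace (T l).
  by have [/linear_relationP] := CR_shift l TCR.
have domT : lr_dom (T l) = setT.
  apply/seteqP; split=> // -[x y] _.
  have [t Bxt] : lr_dom B x by rewrite domB.
  have [s Ays] : lr_dom A y by rewrite domA.
  by exists (s - l *: x, t - l *: y); apply/lr_shiftE; split=> /=; rewrite subrK.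
have := finite_codim_comp TlCR domT fin (finite_codim_antidiag_opp Asub Bsub fin).
move=> /(finite_codimS (ran_antidiag_sqr_sub Asub Bsub)) finX.
split.
  apply: (@finite_codim_image _ _ _ _ _ (fst : hsum H K -> H) (fun x => (x, 0)))
    finX => //.
  by move=> p [].
apply: (@finite_codim_image _ _ _ _ _ (snd : hsum H K -> K) (fun y => (0, y))) finX => //.
by move=> p [].
Qed.
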